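(* Let $\varepsilon\in(0,1)$ and let $T\sim T\left(n,\frac{1-\varepsilon}{n}\right)$. Then there are constants $c_\varepsilon, c'_\varepsilon>0$ depending only on $\varepsilon$ such that for all sufficiently large $n$, $$c_\varepsilon \le \Pr[\chi(T)\le 2]\le 1-c'_\varepsilon.$$
   Context: For $p\in[0,1]$, the $p$-random tournament $T\sim T(n,p)$ on vertex set $[n]$ is obtained by orienting, independently for every $1\le i<j\le n$, the edge $\{i,j\}$ as $\overrightarrow{ji}$ with probability $p$ and as $\overrightarrow{ij}$ with probability $1-p$. A tournament is $k$-colorable if its vertices can be colored with $k$ colors so that each color class induces a transitive subtournament; $\chi(T)$ is the minimum such $k$. *)

(* Defs.v *)
From HB Require Import structures.
From mathcomp Require Import all_boot all_order all_algebra.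
From mathcomp Require Import reals.

Set Implicit Arguments.
Unset Strict Implicit.
Unset Printing Implicit Defensive.

Import Order.TTheory GRing.Theory Num.Theory.

Local Open Scope ring_scope.

Definition is_tournament (V : finType) (A : {set V * V}) : bool :=
  [forall x, (x, x) \notin A] &&
  [forall x, forall y, (x != y) ==> (((x, y) \in A) (+) ((y, x) \in A))].

Record tournament (V : finType) := Tournament {
  arcs : {set V * V};
  arcsP : is_tournament arcs }.

HB.instance Definition _ (V : finType) := [isSub for @arcs V].
HB.instance Definition _ (V : finType) := [Finite of tournament V by <:].

Definition arrow (V : finType) (T : tournament V) : rel V :=
  fun x y => (x, y) \in arcs T.

Lemma arrow_irr (V : finType) (T : tournament V) : irreflexive (arrow T).
Proof. by move=> x; apply/negbTE; have /andP[/forallP/(_ x)] := arcsP T. Qed.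

Definition transitive_on (V : finType) (T : tournament V) (S : {set V}) : bool :=
  [forall x in S, forall y in S, forall z in S,
    arrow T x y ==> arrow T y z ==> arrow T x z].

Definition colorable (V : finType) (T : tournament V) (k : nat) : bool :=
  [exists f : {ffun V -> 'I_k},
    [forall c : 'I_k, transitive_on T [set x | f x == c]]].

Lemma colorable_card (V : finType) (T : tournament V) : colorable T #|V|.
Proof.
apply/existsP; exists [ffun x => enum_rank x]; apply/forallP => c.
do 3![apply/forall_inP => ?; rewrite inE ffunE => /eqP/(canRL enum_rankK) ->].
by rewrite arrow_irr.
Qed.

Definition chromatic_number (V : finType) (T : tournament V) : nat :=
  ex_minn (ex_intro (fun k => colorable T k) #|V| (colorable_card T)).

Section RandomTournament.
Variables (R : realType) (n : nat) (p : R).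

(* The probability mass function of T(n, p): the pairs i < j are oriented
   independently, and p is the probability of the backward arrow j -> i. *)
Definition tournament_pmf (T : tournament 'I_n) : R :=
  \prod_(i < n) \prod_(j < n | (i < j)%N) (if arrow T j i then p else 1 - p).

Definition Pr (E : pred (tournament 'I_n)) : R :=
  \sum_(T | E T) tournament_pmf T.

End RandomTournament.

(* Main.v *)
(** Write G for the random graph of backward arcs, so that G has edge
    probability p = (1 - eps) / n.

    Lower bound: if G is a forest then it is bipartite, and a vertex set without
    edges of G is transitive. "The cycle C is not contained in G" is a decreasing
    event for each C, so by Harris' inequality G is a forest with probability at
    least the product of the 1 - p^|C|, and this is at least
    exp (- 2 sum_k (n p)^k) >= exp (- 2 / eps).

    Upper bound: a triangle a < b < c of G, together with a cyclic triangle
    between a and b and one between b and c, all other pairs being forward,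
    forbids 2-colorings. Such a gadget uses five edges of G; fixing two vertices
    of each cyclic triangle leaves five free vertices, so that the expected number
    of gadgets has order n^5 p^5 = O(1), bounded below, while its second moment is
    bounded. The second moment method concludes. *)
Require Import Defs.
From mathcomp Require Import all_boot all_order all_algebra.
From mathcomp Require Import reals.
From mathcomp.analysis Require Import sequences exp.
From mathcomp Require Import ring lra zify.

Set Implicit Arguments.
Unset Strict Implicit.
Unset Printing Implicit Defensive.

Import Order.TTheory GRing.Theory Num.Theory.

Local Open Scope ring_scope.

(** * Random subsets and Harris' inequality *)

Section BernoulliSubset.
Variables (R : realFieldType) (I : finType) (p : R).
Implicit Types (S A B : {set I}) (f g : {set I} -> R).

Definition bern_wt S : R := \prod_i (if i \in S then p else 1 - p).
Definition bern_Ex f : R := \sum_S bern_wt S * f S.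

Hypotheses (p_ge0 : 0 <= p) (p_le1 : p <= 1).

Lemma bern_wt_ge0 S : 0 <= bern_wt S.
Proof. by apply: prodr_ge0 => i _; case: ifP => _ //; rewrite subr_ge0. Qed.

Lemma bern_Ex_le f g : (forall S, f S <= g S) -> bern_Ex f <= bern_Ex g.
Proof. by move=> le_fg; apply: ler_sum => S _; rewrite ler_wpM2l ?bern_wt_ge0. Qed.

Lemma bern_Ex_eq f g : f =1 g -> bern_Ex f = bern_Ex g.
Proof. by move=> eq_fg; apply: eq_bigr => S _; rewrite eq_fg. Qed.

Lemma bern_ExD f g : bern_Ex (fun S => f S + g S) = bern_Ex f + bern_Ex g.
Proof. by rewrite -big_split; apply: eq_bigr => S _; rewrite mulrDr. Qed.

Lemma bern_ExZ a f : bern_Ex (fun S => a * f S) = a * bern_Ex f.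
Proof. by rewrite mulr_sumr; apply: eq_bigr => S _; rewrite mulrCA. Qed.

Lemma bern_Ex_sum (J : finType) (F : J -> {set I} -> R) :
  bern_Ex (fun S => \sum_j F j S) = \sum_j bern_Ex (F j).
Proof. by rewrite exchange_big; apply: eq_bigr => S _; rewrite mulr_sumr. Qed.

(** Expand [\prod_i (F i + G i)] over subsets: [F] vanishes on [B] and [G] on [A], so only the sets
    of the cylinder survive. A coordinate outside [A] and [B] contributes the factor
    [p + (1 - p) = 1]. *)
Lemma bern_Ex_cylinder A B : [disjoint A & B] ->
  bern_Ex (fun S => ((A \subset S) && [disjoint B & S])%:R)
    = p ^+ #|A| * (1 - p) ^+ #|B|.
Proof.
move=> dAB; pose F i := if i \in B then 0 else p.
pose G i := if i \in A then 0 else 1 - p.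
have -> : p ^+ #|A| * (1 - p) ^+ #|B| = \prod_i (F i + G i).
  rewrite (bigID (mem A)) /= -[in LHS]prodr_const; congr (_ * _).
    apply: eq_bigr => i iA; rewrite /F /G iA.
    by rewrite (disjointFr dAB iA) addr0.
  rewrite (bigID (mem B)) /= [X in _ = _ * X]big1 ?mulr1; last first.
    by move=> i /andP[/negbTE iA /negbTE iB]; rewrite /F /G iA iB addrC subrK.
  rewrite -prodr_const; apply: eq_big => i.
    by case iB: (i \in B); rewrite ?andbF ?(disjointFl dAB iB).
  by move=> iB; rewrite /F /G iB (disjointFl dAB iB) add0r.
rewrite bigA_distr; apply: eq_bigr => S _.
case: (boolP (A \subset S)) => [sAS|/subsetPn[i iA iS]]; last first.
  by rewrite mulr0 (bigD1 i) //= (negbTE iS) /G iA mul0r.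
case: (boolP [disjoint B & S]) => [dBS|]; last first.
  rewrite -setI_eq0 => /set0Pn[i]; rewrite inE => /andP[iB iS].
  by rewrite mulr0 (bigD1 i) //= iS /F iB mul0r.
rewrite mulr1; apply: eq_bigr => i _; case: ifP => iS.
  by rewrite /F (disjointFl dBS iS).
rewrite /G; case: ifP => // iA.
by rewrite (subsetP sAS _ iA) in iS.
Qed.

Lemma bern_Ex_sub A : bern_Ex (fun S => (A \subset S)%:R) = p ^+ #|A|.
Proof.
have d0 : [disjoint A & (set0 : {set I})] by rewrite -setI_eq0 setI0.
rewrite -[RHS]mulr1 -[X in _ * X](expr0 (1 - p)) -(cards0 I).
rewrite -bern_Ex_cylinder //; apply: bern_Ex_eq => S.
by rewrite -setI_eq0 set0I eqxx andbT.
Qed.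

Lemma bern_Ex_cst a : bern_Ex (fun _ => a) = a.
Proof.
have := bern_Ex_sub set0; rewrite cards0 expr0 => E1.
rewrite -[RHS]mulr1 -[X in _ = _ * X]E1 -bern_ExZ; apply: bern_Ex_eq => S.
by rewrite sub0set mulr1.
Qed.

(** The conditional expectation of [f] given all coordinates other than [i]. *)
Definition resample i f S := p * f (i |: S) + (1 - p) * f (S :\ i).

Lemma bern_Ex_resample i f : bern_Ex (resample i f) = bern_Ex f.
Proof.
have split_i h : \sum_(S : {set I}) h S
    = \sum_(S : {set I} | i \notin S) (h (i |: S) + h S) :> R.
  rewrite (bigID (fun S => i \in S)) big_split /=; congr (_ + _).
  rewrite (reindex_onto (fun S => i |: S) (fun S => S :\ i)) /=; last first.
    by move=> S iS; rewrite setD1K.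
  apply: eq_bigl => S; rewrite setU11 /=; apply/eqP/idP => [<-|iS].
    by rewrite !inE eqxx.
  by rewrite setU1K.
rewrite /bern_Ex !split_i; apply: eq_bigr => S iS.
have iE : S :\ i = S by apply/setDidPl; rewrite disjoint_sym disjoints1.
have iU : (i |: S) :\ i = S by rewrite setU1K.
rewrite /resample setUA setUid iU iE -mulrDl /bern_wt.
rewrite !(bigD1 (P := xpredT) i) //= setU11 (negbTE iS).
have -> : \prod_(j | j != i) (if j \in i |: S then p else 1 - p)
        = \prod_(j | j != i) (if j \in S then p else 1 - p).
  by apply: eq_bigr => j /negbTE ji; rewrite !inE ji.
ring.
Qed.

Definition decreasing_fun f := forall A B, A \subset B -> f B <= f A.
Definition depends_on (s : seq I) f :=
  forall A B, {in s, A =i B} -> f A = f B.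

Lemma resample_decreasing i f : decreasing_fun f -> decreasing_fun (resample i f).
Proof.
move=> df A B sAB; apply: lerD; apply: ler_wpM2l; rewrite ?subr_ge0 //.
  by apply: df; apply: setUS.
by apply: df; apply: setSD.
Qed.

Lemma resample_depends i s f : depends_on (i :: s) f -> depends_on s (resample i f).
Proof.
move=> df A B eqAB; congr (_ * _ + _ * _); apply: df => j;
  by rewrite !inE; case: eqP => //= _ /eqAB ->.
Qed.

(** Induction on a list of coordinates that determine [f] and [g]: averaging out one of them
    shortens the list, keeps both functions decreasing and preserves their expectations. *)
Lemma harris f g : decreasing_fun f -> decreasing_fun g ->
  bern_Ex f * bern_Ex g <= bern_Ex (fun S => f S * g S).
Proof.
suff H s : forall f g, decreasing_fun f -> decreasing_fun g ->
    depends_on s f -> depends_on s g ->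
    bern_Ex f * bern_Ex g <= bern_Ex (fun S => f S * g S).
  move=> df dg; apply: (H (enum I)) => //;
    by move=> A B eqAB; congr (_ _); apply/setP => i; apply: eqAB; rewrite mem_enum.
elim: s => [|i s IHs] {}f {}g df dg sf sg.
  have cst h : depends_on [::] h -> bern_Ex h = h set0.
    by move=> sh; rewrite -[RHS]bern_Ex_cst; apply: bern_Ex_eq => S; apply: sh.
  by rewrite !cst // => A B eqAB; rewrite (sf A B) ?(sg A B).
rewrite -(bern_Ex_resample i f) -(bern_Ex_resample i g).
rewrite -(bern_Ex_resample i (fun S => f S * g S)).
apply: (le_trans (IHs _ _ _ _ _ _)); do ?exact: resample_decreasing.
- exact: resample_depends.
- exact: resample_depends.
(* Chebyshev's inequality for the two-point distribution of coordinate [i]. *)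
apply: bern_Ex_le => S; rewrite /resample -subr_ge0.
have sub : S :\ i \subset i |: S.
  exact: subset_trans (subD1set _ _) (subsetUr _ _).
have -> : p * (f (i |: S) * g (i |: S)) + (1 - p) * (f (S :\ i) * g (S :\ i)) -
    (p * f (i |: S) + (1 - p) * f (S :\ i)) *
    (p * g (i |: S) + (1 - p) * g (S :\ i)) =
  p * (1 - p) * ((f (S :\ i) - f (i |: S)) * (g (S :\ i) - g (i |: S))) by ring.
by rewrite !mulr_ge0 ?subr_ge0 // ?df ?dg.
Qed.

Lemma harris_avoid (As : seq {set I}) :
  \prod_(A <- As) (1 - p ^+ #|A|)
    <= bern_Ex (fun S => (all (fun A => ~~ (A \subset S)) As)%:R).
Proof.
elim: As => [|A As IH].
  by rewrite big_nil bern_Ex_cst.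
rewrite big_cons; set g := (fun S => (all _ As)%:R) in IH.
have -> : 1 - p ^+ #|A| = bern_Ex (fun S => (~~ (A \subset S))%:R).
  rewrite -bern_Ex_sub; apply/eqP; rewrite subr_eq -bern_ExD; apply/eqP.
  rewrite -[LHS]bern_Ex_cst; apply: bern_Ex_eq => S.
  by case: (A \subset S); rewrite ?add0r ?addr0.
have pA : 0 <= bern_Ex (fun S => (~~ (A \subset S))%:R).
  by rewrite -[leLHS](bern_Ex_cst 0); apply: bern_Ex_le => S; apply: ler0n.
apply: (le_trans (ler_wpM2l pA IH)).
have dec (Q : pred {set I}) : (forall B C : {set I}, B \subset C -> Q C -> Q B) ->
    decreasing_fun (fun S => (Q S)%:R).
  by move=> QS B C /QS QBC; rewrite ler_nat; case: (Q C) QBC => // ->.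
apply: (le_trans (harris _ _)).
- by apply: dec => B C sBC; apply: contra => /subset_trans; apply.
- apply: dec => B C sBC; apply: sub_all => D.
  by apply: contra => /subset_trans; apply.
by apply: bern_Ex_le => S /=; rewrite -natrM mulnb.
Qed.

End BernoulliSubset.

(** * Acyclic graphs are bipartite *)

Section AcyclicBipartite.
Variables (V : finType) (e : rel V).
Hypotheses (e_sym : symmetric e) (e_irr : irreflexive e).
Hypothesis acyclic_e : forall c : seq V, uniq c -> (2 < size c)%N -> ~~ cycle e c.

(** Otherwise each vertex of [S] has two neighbors in [S], so a path can always be prolonged at its
    front, until it has more than [#|V|] distinct vertices. *)
Lemma acyclic_leaf (S : {set V}) : S != set0 ->
  exists2 v, v \in S & {in S &, forall x y, e v x -> e v y -> x = y}.
Proof.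
case/set0Pn=> v0 v0S; case: (pickP (fun v => (v \in S) &&
  [forall x in S, forall y in S, e v x ==> e v y ==> (x == y)])) => [v|noleaf].
  case/andP=> vS /forall_inP H; exists v => // x y xS yS vx vy.
  by have /forall_inP/(_ y yS) := H x xS; rewrite vx vy => /eqP.
have nbr v w : v \in S -> exists x, [/\ x \in S, e v x & x != w].
  move=> vS; move: (noleaf v); rewrite vS /= => /negbT/forall_inPn[x xS].
  case/forall_inPn=> y yS; rewrite !negb_imply => /and3P[vx vy xy].
  have [xw|] := eqVneq x w; last by exists x.
  by exists y; split=> //; rewrite -xw eq_sym.
have long k : exists v s,
    [/\ size s = k, uniq (v :: s), path e v s & all (mem S) (v :: s)].
  elim: k => [|k [v [s [sz us ps Ss]]]].
    by exists v0, [::]; rewrite /= v0S.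
  have vS : v \in S by case/andP: Ss.
  have [w [wS vw wN]] := nbr v (head v s) vS.
  have wv : w != v by apply: contraTneq vw => ->; rewrite e_irr.
  exists w, (v :: s); split.
  - by rewrite /= sz.
  - rewrite cons_uniq us andbT inE (negbTE wv) /=; apply/negP => ws.
    (* If [w] were already on the path, the segment from [v] to [w] would close a cycle. Its length
       exceeds two because [w] differs from the successor of [v]. *)
    case/splitPr: ws us ps wN => s1 s2 us ps wN.
    have /negP : ~~ cycle e (v :: rcons s1 w).
      apply: acyclic_e.
        by move: us; rewrite -cat_rcons -cat_cons cat_uniq => /andP[].
      case: s1 {us ps} wN => [|? s1 _] /=; first by rewrite eqxx.
      by rewrite size_rcons.
    apply; rewrite /= rcons_path last_rcons e_sym vw andbT.
    by move: ps; rewrite -cat_rcons cat_path => /andP[].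
  - by rewrite /= e_sym vw ps.
  - by rewrite /= wS; exact: Ss.
have [v [s [sz us _ _]]] := long #|V|.
by have := uniq_leq_size us (fun x _ => mem_enum V x); rewrite /= -cardT sz ltnn.
Qed.

(** Induction on the number of vertices: remove a leaf, color the rest, and give the leaf the color
    opposite to that of its only possible neighbor. *)
Lemma acyclic_bipartite : exists f : V -> bool, forall x y, e x y -> f x != f y.
Proof.
suff H n (S : {set V}) : #|S| = n ->
    exists f : V -> bool, {in S &, forall x y, e x y -> f x != f y}.
  by have [f Hf] := H _ [set: V] erefl; exists f => x y; apply: Hf; rewrite inE.
elim: n S => [|n IHn] S cS.
  by exists xpredT => x y; rewrite (cards0_eq cS) inE.
have S0 : S != set0 by rewrite -card_gt0 cS.
have [v vS leaf] := acyclic_leaf S0.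
have [f Hf] : exists f : V -> bool, {in S :\ v &, forall x y, e x y -> f x != f y}.
  by apply: IHn; apply/eqP; rewrite -eqSS -cS (cardsD1 v S) vS.
pose b := if [pick x in S | e v x] is Some x then ~~ f x else true.
exists (fun x => if x == v then b else f x).
have vx x : x \in S -> e v x -> b != f x.
  rewrite /b; case: pickP => [z /andP[zS vz]|/(_ x)/=].
    by move=> xS vx; rewrite (leaf _ _ xS zS vx vz); case: (f z).
  by move=> H xS vx; rewrite xS vx in H.
move=> x y xS yS exy; case: (eqVneq x v) => [xv|xv]; case: (eqVneq y v) => [yv|yv].
- by rewrite xv yv e_irr in exy.
- by apply: vx; rewrite // -xv.
- by rewrite eq_sym; apply: vx; rewrite // -yv e_sym.
- by apply: Hf; rewrite ?inE ?xv ?yv.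
Qed.

End AcyclicBipartite.

Lemma next_next_neq (T : eqType) (c : seq T) x :
  uniq c -> (2 < size c)%N -> x \in c -> next c (next c x) != x.
Proof.
move=> uc sc xc; have [i s def_c] := rot_to xc.
rewrite -!(next_rot i uc).
move: uc sc; rewrite -(rot_uniq i) -(size_rot i) def_c.
case: s {def_c} => [|a [|b s]] //= /and3P[+ _ _] _; rewrite !inE !negb_or eqxx.
by case/and3P=> /negbTE xa xb _; rewrite [a == x]eq_sym xa eqxx eq_sym.
Qed.

(** * The graph of backward arcs *)

Lemma arrow_anti (V : finType) (T : tournament V) (x y : V) :
  x != y -> arrow T y x = ~~ arrow T x y.
Proof.
move=> xy; have /andP[_ /forallP/(_ x)/forallP/(_ y)] := arcsP T.
by rewrite xy /= /arrow; case: (_ \in _); case: (_ \in _).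
Qed.

Lemma colorable_mono (V : finType) (T : tournament V) k l :
  (k <= l)%N -> colorable T k -> colorable T l.
Proof.
move=> kl /existsP[f /forallP fT]; apply/existsP; exists [ffun x => widen_ord kl (f x)].
apply/forallP => c; apply/forall_inP => x; rewrite inE ffunE => /eqP fx.
apply/forall_inP => y; rewrite inE ffunE => /eqP fy.
apply/forall_inP => z; rewrite inE ffunE => /eqP fz.
have /forall_inP/(_ x)/= := fT (f x); rewrite inE eqxx => /(_ isT)/forall_inP/(_ y).
have eqf u : widen_ord kl (f u) = c -> f u == f x
  by move=> fu; apply/eqP/val_inj; apply: (congr1 val (etrans fu (esym fx))).
by rewrite inE eqf // => /(_ isT)/forall_inP/(_ z); rewrite inE eqf // => /(_ isT).
Qed.

Lemma chromatic_number_le (V : finType) (T : tournament V) k :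
  (chromatic_number T <= k)%N = colorable T k.
Proof.
rewrite /chromatic_number; case: ex_minnP => m mT min.
by apply/idP/idP => [mk|/min//]; apply: colorable_mono mT.
Qed.

Section BackEdges.
Variable n : nat.
Implicit Types (S : {set 'I_n * 'I_n}) (x y : 'I_n).

Definition back_arcs S : {set 'I_n * 'I_n} :=
  [set u : 'I_n * 'I_n | if (u.1 < u.2)%N then u \notin S
                         else (u.2 < u.1)%N && ((u.2, u.1) \in S)].

Lemma back_arcsP S : is_tournament (back_arcs S).
Proof.
apply/andP; split; first by apply/forallP => x; rewrite inE /= ltnn.
apply/forallP => x; apply/forallP => y; apply/implyP; rewrite -val_eqE neq_ltn !inE /=.
by case: ltngtP => //= _ _; [rewrite addNb addbb | rewrite addbN addbb].
Qed.

(* Pairs [(x, y)] of [S] with [y <= x] are ignored, so that all coordinates of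
   [S] can be independent coin tosses. *)
Definition back_tournament S : tournament 'I_n := Tournament (back_arcsP S).

Lemma arrow_back S x y : arrow (back_tournament S) x y =
  if (x < y)%N then (x, y) \notin S else (y < x)%N && ((y, x) \in S).
Proof. by rewrite /arrow inE. Qed.

Definition forward_pairs : {set 'I_n * 'I_n} := [set u : 'I_n * 'I_n | (u.1 < u.2)%N].
Definition backward_pairs (T : tournament 'I_n) : {set 'I_n * 'I_n} :=
  [set u in forward_pairs | arrow T u.2 u.1].

(** Exhibits the fiber of [back_tournament] over [T] as a cylinder that prescribes exactly the
    forward pairs, so that [bern_Ex_cylinder] gives its probability. *)
Lemma back_tournament_eq S (T : tournament 'I_n) :
  (back_tournament S == T) = (backward_pairs T \subset S)
      && [disjoint forward_pairs :\: backward_pairs T & S].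
Proof.
apply/eqP/andP => [<-|[/subsetP sub dis]].
  split; first by apply/subsetP => -[x y]; rewrite !inE /= arrow_back; case: ltngtP.
  rewrite -setI_eq0; apply/eqP/setP => -[x y]; rewrite !inE /= arrow_back.
  by case: ltngtP => //=; case: (_ \in S).
apply: val_inj; apply/setP => -[x y] /=; rewrite inE /= -[RHS]/(arrow T x y).
have H (a b : 'I_n) : (a < b)%N -> ((a, b) \in S) = arrow T b a.
  move=> ab; apply/idP/idP => [abS|Tba]; last by apply: sub; rewrite !inE /= ab.
  by move: (disjointFl dis abS); rewrite !inE /= ab andbT /= => /negbFE.
case: ltngtP => [xy|yx|/val_inj ->] /=.
- by rewrite H // -arrow_anti // -val_eqE /= gtn_eqF.
- by rewrite H.
- by rewrite arrow_irr.
Qed.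

Variables (R : realType) (p : R).

Lemma pmf_back T :
  tournament_pmf p T = bern_Ex p (fun S => (back_tournament S == T)%:R).
Proof.
under bern_Ex_eq do rewrite back_tournament_eq.
rewrite bern_Ex_cylinder; last by rewrite -setI_eq0 setIDA setIC setDIl setDv setI0.
rewrite /tournament_pmf pair_big_dep /=.
rewrite (bigID (fun u => arrow T u.2 u.1)) /= -!prodr_const; congr (_ * _).
  by apply: eq_big => [[x y]|[x y] /andP[_ /= ->]] //; rewrite !inE.
apply: eq_big => [[x y]|[x y] /andP[_ /= /negbTE ->]] //; rewrite !inE /=.
by case: (x < y)%N => /=; rewrite ?andbT ?andbF.
Qed.

(** Moves events on tournaments to a product space of independent bits, the setting of Harris'
    inequality and of the moment computations. *)
Lemma Pr_back (E : pred (tournament 'I_n)) :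
  Pr p E = bern_Ex p (fun S => (E (back_tournament S))%:R).
Proof.
rewrite /Pr; under eq_bigr do rewrite pmf_back.
rewrite exchange_big /=; apply: eq_bigr => S _; rewrite -mulr_sumr; congr (_ * _).
rewrite -natr_sum; congr (_%:R); rewrite big_mkcond /=.
rewrite (bigD1 (back_tournament S)) //= eqxx big1 ?addn0 => [|T /negbTE].
  by case: (E _).
by rewrite eq_sym => ->; case: (E _).
Qed.

Definition back_adj S : rel 'I_n :=
  fun x y => (x < y)%N && ((x, y) \in S) || (y < x)%N && ((y, x) \in S).

Lemma back_adj_sym S : symmetric (back_adj S).
Proof. by move=> x y; rewrite /back_adj orbC. Qed.

Lemma back_adj_irr S : irreflexive (back_adj S).
Proof. by move=> x; rewrite /back_adj ltnn. Qed.

Lemma bipartite_back_colorable S (f : 'I_n -> bool) :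
  (forall x y, back_adj S x y -> f x != f y) -> colorable (back_tournament S) 2.
Proof.
move=> bip; apply/existsP; exists [ffun x => inord (f x)].
apply/forallP => c; apply/forall_inP => x; rewrite inE ffunE => /eqP fx.
apply/forall_inP => y; rewrite inE ffunE => /eqP fy.
apply/forall_inP => z; rewrite inE ffunE => /eqP fz.
have fE u : inord (f u) = c -> f u = (c == 1%N :> nat).
  by move=> <-; rewrite inordK; case: (f u).
(* Inside a color class no arc is backward, so arrows follow the order of the indices. *)
have fwd u v : f u = f v -> arrow (back_tournament S) u v = (u < v)%N.
  move=> fuv; have := bip u v; rewrite arrow_back /back_adj fuv eqxx.
  by case: ltngtP => //= _; case: (_ \in S) => // /(_ isT).
rewrite !fwd ?(fE _ fx) ?(fE _ fy) ?(fE _ fz) //.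
by apply/implyP => xy; apply/implyP; apply: ltn_trans.
Qed.

(** * Cycles of backward arcs *)

Definition upair x y : 'I_n * 'I_n := if (x < y)%N then (x, y) else (y, x).

Lemma back_adjE S x y : back_adj S x y = (x != y) && (upair x y \in S).
Proof. by rewrite /back_adj /upair -val_eqE; case: ltngtP => //=; rewrite orbF. Qed.

Definition cycle_pairs (c : seq 'I_n) : {set 'I_n * 'I_n} :=
  [set upair x (next c x) | x in c].

(** Distinct vertices with the same pair would be successors of each other, which only happens in a
    cycle of length two. *)
Lemma card_cycle_pairs c : uniq c -> (2 < size c)%N -> #|cycle_pairs c| = size c.
Proof.
move=> uc sc; rewrite card_in_imset; first by apply/card_uniqP.
move=> x y xc yc; rewrite /upair.
have nn z : z \in c -> next c (next c z) != z by apply: next_next_neq.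
have swap : x = next c y -> next c x = y -> x = y.
  by move=> xE yE; have := nn x xc; rewrite yE -xE eqxx.
by do 2!case: ifP => _; case=> E1 E2 //; apply: swap.
Qed.

Lemma cycle_pairs_sub S c : cycle (back_adj S) c -> cycle_pairs c \subset S.
Proof.
move=> cc; apply/subsetP => _ /imsetP[x xc ->].
by have := next_cycle cc xc; rewrite back_adjE => /andP[].
Qed.

(** Each cycle is listed once per starting point and direction; this overcounting only weakens the
    final constant. Length at most [n] suffices for sequences without repetition. *)
Definition long_cycles : seq (seq 'I_n) :=
  [seq c <- flatten [seq [seq val t | t <- enum {: k.-tuple 'I_n}] | k <- iota 0 n.+1]
     | uniq c && (2 < size c)%N].

Lemma mem_long_cycles c : (c \in long_cycles) = uniq c && (2 < size c)%N.
Proof.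
rewrite mem_filter; apply: andb_idr => /andP[uc _].
apply/flatten_mapP; exists (size c).
  rewrite mem_iota /= add0n ltnS -[n in (_ <= n)%N]card_ord cardT.
  by apply: uniq_leq_size => // x _; rewrite mem_enum.
by apply/mapP; exists (in_tuple c); rewrite ?mem_enum.
Qed.

Lemma avoid_cycles_colorable S :
  all (fun A : {set 'I_n * 'I_n} => ~~ (A \subset S)) (map cycle_pairs long_cycles) ->
  colorable (back_tournament S) 2.
Proof.
rewrite all_map => /allP avoid.
have [f Hf] : exists f : 'I_n -> bool, forall x y, back_adj S x y -> f x != f y.
  apply: acyclic_bipartite; [exact: back_adj_sym | exact: back_adj_irr |].
  move=> c uc sc; apply: contra (avoid c _); last by rewrite mem_long_cycles uc.
  exact: cycle_pairs_sub.
exact: bipartite_back_colorable Hf.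
Qed.

Hypotheses (p_ge0 : 0 <= p) (p_le1 : p <= 1).

Lemma Pr_colorable_ge :
  \prod_(c <- long_cycles) (1 - p ^+ size c) <= Pr (n := n) p (fun T => colorable T 2).
Proof.
rewrite Pr_back.
pose f S : R := (all (fun A : {set 'I_n * 'I_n} => ~~ (A \subset S))
  (map cycle_pairs long_cycles))%:R.
apply: (@le_trans _ _ (bern_Ex p f)); last first.
  apply: bern_Ex_le => // S; rewrite ler_nat.
  by case: (boolP (all _ _)) => // /avoid_cycles_colorable ->.
apply: le_trans (harris_avoid p_ge0 p_le1 _); rewrite big_map.
by rewrite le_eqVlt; apply/orP; left; apply/eqP; apply: eq_big_seq => c;
   rewrite mem_long_cycles => /andP[uc sc]; rewrite card_cycle_pairs.
Qed.

Lemma sum_long_cycles :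
  \sum_(c <- long_cycles) p ^+ size c <= \sum_(k < n.+1) (n%:R * p) ^+ k.
Proof.
rewrite big_filter big_mkcond big_flatten big_map.
rewrite -(big_mkord xpredT (fun k => (n%:R * p) ^+ k)) /index_iota subn0.
apply: ler_sum => k _; rewrite big_map big_enum /=.
apply: (@le_trans _ _ (\sum_(t : k.-tuple 'I_n) p ^+ k)).
  by apply: ler_sum => t _; rewrite size_tuple; case: ifP => // _; apply: exprn_ge0.
by rewrite sumr_const card_tuple card_ord exprMn -natrX mulr_natl.
Qed.

End BackEdges.

(** * Obstructions to 2-colorability *)

(* The gadget: the vertices 0 < 4 < 8 span a triangle of backward arcs, and
   1 -> 2 -> 3 -> 1 and 5 -> 6 -> 7 -> 5 are cyclic triangles lying between
   two of its vertices.  Two of 0, 4, 8 have the same color, which then cannot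
   be used on a cyclic triangle lying between them. *)
Definition gadget_pairs : seq (nat * nat) :=
  [:: (0, 4); (4, 8); (0, 8); (1, 3); (5, 7)]%N.

Lemma gadget_not_2colorable (V : finType) (T : tournament V) (v : nat -> V) :
  (forall k l, (k < l < 9)%N -> v k != v l) ->
  (forall k l, (k < l < 9)%N -> arrow T (v l) (v k) = ((k, l) \in gadget_pairs)) ->
  ~~ colorable T 2.
Proof.
move=> v_inj v_back; apply/negP => /existsP[f /forallP fT].
pose b k : bool := f (v k) == 0.
have fwd k l : (k < l < 9)%N -> arrow T (v k) (v l) = ((k, l) \notin gadget_pairs).
  move=> kl; have /(arrow_anti T)-> : v l != v k by rewrite eq_sym v_inj.
  by rewrite v_back.
have fb k l : b k = b l -> f (v k) = f (v l).
  rewrite /b; case: (f (v k)) (f (v l)) => [[|[|//]] ?] [[|[|//]] ?] //= _;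
  exact: val_inj.
(* Here [(k, j)] is the only backward pair among the three vertices, so [k -> l -> j -> k] is a
   cycle and cannot be monochromatic. *)
have tri k l j : (k < l)%N && (l < j < 9)%N -> (k, l) \notin gadget_pairs ->
    (l, j) \notin gadget_pairs -> (k, j) \in gadget_pairs ->
    ~~ ((b k == b l) && (b l == b j)).
  move=> /and3P[kl lj j9] nkl nlj ikj; apply/negP => /andP[/eqP/fb ekl /eqP/fb elj].
  have /forall_inP/(_ (v k)) := fT (f (v k)); rewrite inE eqxx => /(_ isT).
  move=> /forall_inP/(_ (v l)); rewrite inE ekl eqxx => /(_ isT).
  move=> /forall_inP/(_ (v j)); rewrite inE elj eqxx => /(_ isT).
  rewrite !fwd ?nkl ?nlj ?ikj //; lia.
(* With two colors, three vertices that avoid the common color of [x] and [y] all have the other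
   one. *)
have between (x y u1 u2 u3 : bool) : x = y -> ~~ ((x == u1) && (u1 == y)) ->
    ~~ ((x == u2) && (u2 == y)) -> ~~ ((x == u3) && (u3 == y)) ->
    (u1 == u2) && (u2 == u3).
  by case: x; case: y; case: u1; case: u2; case: u3.
have : [|| b 0 == b 4, b 4 == b 8 | b 0 == b 8]%N.
  by case: (b 0%N); case: (b 4%N); case: (b 8%N).
case/or3P=> /eqP eq_b.
- have := tri 1%N 2%N 3%N isT isT isT isT.
  by rewrite (between _ _ _ _ _ eq_b (tri 0%N 1%N 4%N isT isT isT isT)
    (tri 0%N 2%N 4%N isT isT isT isT) (tri 0%N 3%N 4%N isT isT isT isT)).
- have := tri 5%N 6%N 7%N isT isT isT isT.
  by rewrite (between _ _ _ _ _ eq_b (tri 4%N 5%N 8%N isT isT isT isT)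
    (tri 4%N 6%N 8%N isT isT isT isT) (tri 4%N 7%N 8%N isT isT isT isT)).
(* The vertices 1, 2, 3 also lie between 0 and 8, so the first cyclic triangle serves again. *)
- have := tri 1%N 2%N 3%N isT isT isT isT.
  by rewrite (between _ _ _ _ _ eq_b (tri 0%N 1%N 8%N isT isT isT isT)
    (tri 0%N 2%N 8%N isT isT isT isT) (tri 0%N 3%N 8%N isT isT isT isT)).
Qed.

(** * Counting gadgets: first and second moments *)

Section Gadgets.
Variables (n m : nat) (m_gt0 : (0 < m)%N) (mn : (9 * m <= n)%N).
Implicit Types (t : {ffun 'I_5 -> 'I_m}) (S : {set 'I_n * 'I_n}).

(* [gadget_key i] is an endpoint of the pair [i] of [gadget_pairs]. The vertex
   [k] of the gadget is put in the block [[k * m, (k + 1) * m[], at a free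
   position if [k] is a key and at the beginning of the block otherwise. *)
Definition gadget_key : seq nat := [:: 0; 4; 8; 3; 7]%N.

Definition gadget_offset t (k : nat) : nat :=
  if insub (index k gadget_key) is Some i then t i else 0%N.

(** The cap at 8 keeps the position below [n] for every natural number [k], which makes [gadget_vtx]
    total. *)
Definition gadget_pos t (k : nat) : nat := (minn k 8 * m + gadget_offset t k)%N.

Lemma gadget_offset_lt t k : (gadget_offset t k < m)%N.
Proof. by rewrite /gadget_offset; case: insub. Qed.

Lemma gadget_offset_key t (i : 'I_5) :
  gadget_offset t (nth 0%N gadget_key i) = t i.
Proof. by rewrite /gadget_offset index_uniq // ?valK // ltn_ord. Qed.

Lemma gadget_pos_lt t k : (gadget_pos t k < n)%N.
Proof. by have := gadget_offset_lt t k; rewrite /gadget_pos; nia. Qed.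

Definition gadget_vtx t k : 'I_n := Ordinal (gadget_pos_lt t k).

Lemma gadget_vtx_lt t k l : (k < l < 9)%N -> (gadget_vtx t k < gadget_vtx t l)%N.
Proof.
by move=> kl; have := gadget_offset_lt t k; rewrite /= /gadget_pos !(minn_idPl _); nia.
Qed.

Lemma gadget_vtx_inj t t' k l : (k < 9)%N -> (l < 9)%N ->
  gadget_vtx t k = gadget_vtx t' l -> k = l /\ gadget_offset t k = gadget_offset t' l.
Proof.
move=> k9 l9 /(congr1 val) /=; rewrite /gadget_pos !(minn_idPl _) // => E.
have kl : k = l.
  move: (congr1 (divn^~ m) E).
  by rewrite /= !divnMDl // !divn_small ?gadget_offset_lt // !addn0.
by split=> //; move: E; rewrite kl => /addnI.
Qed.

Definition gadget_arc t (i : 'I_5) : 'I_n * 'I_n :=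
  let kl := nth (0, 0)%N gadget_pairs i in (gadget_vtx t kl.1, gadget_vtx t kl.2).

(** The blocks of the two endpoints identify the pair, and the offset of its key endpoint is the
    free coordinate. *)
Lemma gadget_arc_inj t t' i j :
  gadget_arc t i = gadget_arc t' j -> i = j /\ t i = t' j.
Proof.
have lt9 (h : 'I_5) : let kl := nth (0, 0)%N gadget_pairs h in
    [&& (kl.1 < 9)%N, (kl.2 < 9)%N &
        (nth 0%N gadget_key h == kl.1) || (nth 0%N gadget_key h == kl.2)].
  by case: h => [[|[|[|[|[|//]]]]] ?].
have /and3P[i1 i2 key] := lt9 i; have /and3P[j1 j2 _] := lt9 j.
move=> E; have [E1 O1] := gadget_vtx_inj i1 j1 (congr1 fst E).
have [E2 O2] := gadget_vtx_inj i2 j2 (congr1 snd E).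
have ij : i = j.
  apply/val_inj/eqP; rewrite -(nth_uniq (0, 0)%N (s := gadget_pairs)) ?ltn_ord //.
  by apply/eqP; rewrite [LHS]surjective_pairing [RHS]surjective_pairing E1 E2.
rewrite -ij in O1 O2 *; split=> //; apply: val_inj => /=.
by rewrite -!gadget_offset_key; case/orP: key => /eqP ->.
Qed.

Definition gadget_in t := [set gadget_arc t i | i : 'I_5].
Definition gadget_out t := [set (gadget_vtx t kl.1, gadget_vtx t kl.2) |
  kl : 'I_9 * 'I_9 & (kl.1 < kl.2)%N && ((val kl.1, val kl.2) \notin gadget_pairs)].

Lemma gadget_disjoint t : [disjoint gadget_in t & gadget_out t].
Proof.
rewrite -setI_eq0; apply/eqP/setP => u; rewrite !inE; apply/negP.
case/andP=> /imsetP[i _ ->] /imsetP[[k l]]; rewrite inE /= => /andP[_ kl].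
have /andP[i1 i2] : ((nth (0, 0)%N gadget_pairs i).1 < 9)%N &&
    ((nth (0, 0)%N gadget_pairs i).2 < 9)%N.
  by case: i => [[|[|[|[|[|//]]]]] ?].
move=> E; have [E1 _] := gadget_vtx_inj i1 (ltn_ord k) (congr1 fst E).
have [E2 _] := gadget_vtx_inj i2 (ltn_ord l) (congr1 snd E).
case/negP: kl; rewrite /= -E1 -E2 -surjective_pairing.
by apply: mem_nth; apply: ltn_ord.
Qed.

Definition gadget_at t S := (gadget_in t \subset S) && [disjoint gadget_out t & S].

Lemma gadget_at_not_2colorable t S :
  gadget_at t S -> ~~ colorable (back_tournament S) 2.
Proof.
case/andP=> /subsetP inS outS.
apply: (gadget_not_2colorable (v := gadget_vtx t)) => k l kl.
  by rewrite -val_eqE neq_ltn gadget_vtx_lt.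
have lt := gadget_vtx_lt t kl; rewrite arrow_back ltnNge (ltnW lt) lt /=.
have /andP[kltl l9] := kl; have k9 := ltn_trans kltl l9.
case: (boolP (_ \in gadget_pairs)) => [ikl|nkl].
  apply: inS; have i5 : (index (k, l) gadget_pairs < 5)%N by rewrite index_mem.
  by apply/imsetP; exists (Ordinal i5); rewrite // /gadget_arc nth_index.
apply: (disjointFr outS); apply/imsetP; exists (Ordinal k9, Ordinal l9) => //.
by rewrite inE /= kltl.
Qed.

Lemma card_gadget_in t : (#|gadget_in t| <= 5)%N.
Proof. by rewrite -[leqRHS](card_ord 5); apply: leq_imset_card. Qed.

Lemma card_gadget_out t : (#|gadget_out t| <= 81)%N.
Proof.
apply: leq_trans (leq_imset_card _ _) _.
by apply: leq_trans (max_card _) _; rewrite card_prod card_ord.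
Qed.

(** By [gadget_arc_inj], each coordinate where [t'] differs from [t] adds a pair outside
    [gadget_in t]. *)
Lemma card_gadget_inU t t' :
  (5 + #|[set i | t i != t' i]| <= #|gadget_in t :|: gadget_in t'|)%N.
Proof.
set D := [set i | _].
have inj s : injective (gadget_arc s) by move=> i j /gadget_arc_inj[].
have E5 : #|gadget_in t| = 5%N by rewrite card_imset // card_ord.
have ED : #|[set gadget_arc t' i | i in D]| = #|D| by rewrite card_imset.
have I0 : gadget_in t :&: [set gadget_arc t' i | i in D] = set0.
  apply/setP => u; rewrite !inE; apply/negP => /andP[/imsetP[i _ ->] /imsetP[j]].
  by rewrite inE => /eqP tj /gadget_arc_inj[ij]; rewrite ij.
rewrite -[X in (X + _)%N]E5 -ED -cardsUI I0 cards0 addn0.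
by apply/subset_leq_card/setUS/imsetS/subsetP.
Qed.

Variables (R : realType) (p : R).
Hypotheses (p_ge0 : 0 <= p) (p_le : p <= 2^-1) (mp_le1 : m%:R * p <= 1).

Definition gadget_count S : R := \sum_t (gadget_at t S)%:R.

(** There are [m ^ 5] placements, each requiring at most 5 pairs present and, by the crude count
    [9 * 9], at most 81 absent, where [1 - p] is at least one half. *)
Lemma Ex_gadget_count : (m%:R * p) ^+ 5 * 2^-1 ^+ 81 <= bern_Ex p gadget_count.
Proof.
have p_le1 : p <= 1 by move: p_le; lra.
rewrite bern_Ex_sum.
apply: (@le_trans _ _ (\sum_(t : {ffun 'I_5 -> 'I_m}) (p ^+ 5 * 2^-1 ^+ 81))).
  by rewrite sumr_const card_ffun !card_ord -[leRHS]mulr_natl natrX exprMn mulrA.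
apply: ler_sum => t _; rewrite bern_Ex_cylinder ?gadget_disjoint //.
apply: ler_pM; rewrite ?exprn_ge0 ?invr_ge0 //.
  by apply: ler_wiXn2l; rewrite ?card_gadget_in.
apply: (@le_trans _ _ (2^-1 ^+ #|gadget_out t|)).
  by apply: ler_wiXn2l; rewrite ?card_gadget_out ?invr_ge0 ?invf_le1 ?ler1n.
by apply: lerXn2r; rewrite ?nnegrE; move: p_le; lra.
Qed.

(** Drop the absent pairs. For fixed [t], the sum over [t'] factors over the five coordinates; each
    factor is 1 for agreement plus at most [m * p <= 1] for disagreement, hence at most 2. *)
Lemma Ex_gadget_count_sqr : bern_Ex p (fun S => gadget_count S ^+ 2) <= 32.
Proof.
have p_le1 : p <= 1 by move: p_le; lra.
apply: (@le_trans _ _ (bern_Ex p (fun S => \sum_t \sum_t'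
    (gadget_in t :|: gadget_in t' \subset S)%:R))).
  apply: bern_Ex_le => // S; rewrite expr2 mulr_suml; apply: ler_sum => t _.
  rewrite mulr_sumr; apply: ler_sum => t' _; rewrite -natrM mulnb ler_nat.
  rewrite subUset /gadget_at; case: (_ \subset _) => //=.
  by case: (_ \subset _); rewrite ?andbF ?leq_b1.
rewrite bern_Ex_sum.
apply: (@le_trans _ _ (\sum_(t : {ffun 'I_5 -> 'I_m}) (p ^+ 5 * 2 ^+ 5))); last first.
  rewrite sumr_const card_ffun !card_ord -[leLHS]mulr_natl natrX mulrA -exprMn.
  have -> : 32 = 1 ^+ 5 * 2 ^+ 5 :> R by ring.
  rewrite ler_wpM2r ?exprn_ge0 // lerXn2r ?nnegrE ?mulr_ge0 //.
apply: ler_sum => t _; rewrite bern_Ex_sum.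
have H t' : bern_Ex p (fun S => (gadget_in t :|: gadget_in t' \subset S)%:R)
    <= p ^+ 5 * \prod_i (if t i != t' i then p else 1).
  rewrite bern_Ex_sub -big_mkcond /=.
  have -> : \prod_(i | t i != t' i) p = p ^+ #|[set i | t i != t' i]|.
    by rewrite -prodr_const; apply: eq_bigl => i; rewrite inE.
  by rewrite -exprD; apply: ler_wiXn2l => //; apply: card_gadget_inU.
apply: le_trans (ler_sum _ (fun t' _ => H t')) _.
rewrite -mulr_sumr ler_wpM2l ?exprn_ge0 //.
rewrite -(bigA_distr_bigA (fun i u => if t i != u then p else 1)).
rewrite -[X in 2 ^+ X](card_ord 5) -prodr_const; apply: ler_prod => i _.
apply/andP; split; first by apply: sumr_ge0 => u _; case: ifP.
rewrite (bigD1 (t i)) //= eqxx /= -[leRHS]/(1 + 1) lerD2l.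
apply: le_trans mp_le1; rewrite -[m in leRHS](card_ord m) mulr_natl -sumr_const.
rewrite [leLHS]big_mkcond; apply: ler_sum => u _.
by case: ifP => // /negbTE; rewrite eq_sym => ->.
Qed.

Lemma Pr_colorable_le kappa : 0 <= kappa -> kappa <= (m%:R * p) ^+ 5 * 2^-1 ^+ 81 ->
  Pr (n := n) p (fun T => colorable T 2) <= 1 - kappa ^+ 2 / 32.
Proof.
move=> k_ge0 /le_trans/(_ Ex_gadget_count) EZ; have EZ2 := Ex_gadget_count_sqr.
have p_le1 : p <= 1 by move: p_le; lra.
(* This [s] minimizes [1 - 2 * s * kappa + 32 * s ^ 2], the bound obtained by averaging
   [(1 - s * Z) ^ 2] for the gadget count [Z]. *)
pose s := kappa / 32; have s_ge0 : 0 <= s by rewrite /s; lra.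
apply: (@le_trans _ _ (bern_Ex p (fun S =>
    1 + (- (2 * s) * gadget_count S + s ^+ 2 * gadget_count S ^+ 2)))).
  rewrite Pr_back; apply: bern_Ex_le => // S.
  (* [2 s Z - s^2 Z^2 <= 1] always, with value [0] when [Z = 0]. *)
  have [/existsP[t /gadget_at_not_2colorable/negbTE ->]|] :=
    boolP [exists t, gadget_at t S].
    have := sqr_ge0 (1 - s * gadget_count S); rewrite sqrrB expr1n exprMn /=; lra.
  rewrite negb_exists => /forallP none.
  rewrite /gadget_count big1 => [|t _]; last by rewrite (negbTE (none t)).
  by rewrite expr0n !mulr0 !addr0 lern1 leq_b1.
rewrite !bern_ExD !bern_ExZ bern_Ex_cst.
have := ler_wpM2l s_ge0 EZ; have := ler_wpM2l (sqr_ge0 s) EZ2.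
rewrite /s; nra.
Qed.

End Gadgets.

(** * Real estimates and the choice of constants *)

(** Combine [1 + 2 * x <= expR (2 * x)] with [(1 - x) * (1 + 2 * x) >= 1], valid up to one half. *)
Lemma expR_le_1B (R : realType) (x : R) :
  0 <= x -> x <= 2^-1 -> expR (- (2 * x)) <= 1 - x.
Proof.
move=> x_ge0 x_le; have x_lt1 : 0 < 1 - x by lra.
rewrite expRN invf_ple ?posrE ?expR_gt0 //; apply: le_trans (expR_ge1Dx _).
by rewrite -[leLHS]mul1r ler_pdivrMr //; nra.
Qed.

Lemma geometric_sum_le (R : realFieldType) (x : R) N :
  0 <= x -> x < 1 -> \sum_(k < N) x ^+ k <= (1 - x)^-1.
Proof.
move=> x_ge0 x_lt1; have x1 : 0 < 1 - x by lra.
rewrite -[leRHS]mul1r ler_pdivlMr // mulrC -opprB mulNr -subrX1 opprB.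
by have := exprn_ge0 N x_ge0; lra.
Qed.

Theorem theorem1p5 (R : realType) (eps : R) (eps_gt0 : 0 < eps)
    (eps_lt1 : eps < 1) :
  exists c c' : R, [/\ 0 < c, 0 < c' &
    exists N : nat, forall n : nat, (N <= n)%N ->
      c <= Pr (n := n) ((1 - eps) / n%:R) (fun T => (chromatic_number T <= 2)%N)
        <= 1 - c'].
Proof.
(* With blocks of size [n %/ 9], at least [n / 18] once [n >= 9], the first moment is at least
   [kappa]. *)
pose kappa : R := ((1 - eps) / 18) ^+ 5 * 2^-1 ^+ 81.
have kappa_gt0 : 0 < kappa.
  by rewrite mulr_gt0 ?exprn_gt0 ?invr_gt0 //; lra.
(* The exponent is twice the geometric series of ratio [1 - eps], whose sum is [1 / eps]. *)
exists (expR (- (2 / eps))), (kappa ^+ 2 / 32); split.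
- exact: expR_gt0.
- by rewrite divr_gt0 ?exprn_gt0.
(* From 9 on, the blocks are nonempty and [p] is below one half. *)
exists 9%N => n n9; set p := (1 - eps) / n%:R.
have n_gt0 : 0 < n%:R :> R by rewrite ltr0n; lia.
have np : n%:R * p = 1 - eps by rewrite /p mulrC divfK ?gt_eqF.
have p_ge0 : 0 <= p by apply: divr_ge0; lra.
have p_le : p <= 2^-1.
  rewrite /p ler_pdivrMr //.
  have : 9%:R <= n%:R :> R by rewrite ler_nat.
  lra.
have p_le1 : p <= 1 by lra.
have -> : Pr (n := n) p (fun T => (chromatic_number T <= 2)%N)
    = Pr (n := n) p (fun T => colorable T 2).
  by apply: eq_bigl => T; rewrite chromatic_number_le.
apply/andP; split.
  apply: le_trans _ (Pr_colorable_ge n p_ge0 p_le1).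
  apply: (@le_trans _ _ (\prod_(c <- long_cycles n) expR (- (2 * p ^+ size c)))).
    rewrite -expR_sum ler_expR sumrN lerN2 -mulr_sumr ler_wpM2l //.
    apply: le_trans (sum_long_cycles n p_ge0) _; rewrite np.
    have := @geometric_sum_le _ (1 - eps) n.+1; rewrite subKr.
    by apply; lra.
  rewrite !big_seq; apply: ler_prod => c; rewrite mem_long_cycles => /andP[_ c3].
  rewrite expR_ge0 expR_le_1B ?exprn_ge0 //; apply: le_trans p_le.
  by rewrite -[leRHS]expr1; apply: ler_wiXn2l (ltnW (ltnW c3)).
have m_gt0 : (0 < n %/ 9)%N by rewrite divn_gt0.
have mn : (9 * (n %/ 9) <= n)%N by rewrite mulnC leq_trunc_div.
apply: (Pr_colorable_le m_gt0 mn) => //; last 1 first.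
- have np_le : (1 - eps) / 18 <= (n %/ 9)%:R * p.
    have : n%:R <= 18 * (n %/ 9)%:R :> R by rewrite -natrM ler_nat; lia.
    by move=> /(ler_wpM2r p_ge0); rewrite np; lra.
  have eps1 : 0 <= (1 - eps) / 18 by lra.
  apply: ler_wpM2r; first by rewrite exprn_ge0 ?invr_ge0.
  by apply: lerXn2r; rewrite ?nnegrE ?(le_trans eps1).
- apply: (@le_trans _ _ (n%:R * p)); last by rewrite np; lra.
  by rewrite ler_wpM2r // ler_nat leq_div.
- exact: ltW.
Qed.
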